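(* Let $w$ be a dyadic $A_1$ weight on $\mathbb{R}^n$ with dyadic $A_1$ constant $[w]^d_1=c$, and let $Q$ be a fixed dyadic cube in $\mathbb{R}^n$. Let $(w/Q)^\ast:(0,|Q|]\to\mathbb{R}^+$ denote the non-increasing rearrangement of the restriction of $w$ to $Q$. Then $$\frac{1}{t}\int_0^t (w/Q)^\ast(y)\,dy\le (2^n c-2^n+1)\,(w/Q)^\ast(t)\qquad\text{for every } t\in(0,|Q|].$$ Moreover, this inequality is sharp when one considers all dyadic $A_1$ weights with $[w]^d_1=c$: for every $c\ge 1$, the constant $2^n c-2^n+1$ cannot be replaced by any smaller constant for which the inequality holds for all dyadic $A_1$ weights $w$ on $\mathbb{R}^n$ with $[w]^d_1=c$ and all $t\in(0,|Q|]$.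
   Context: $|\cdot|$ denotes Lebesgue measure. A locally integrable non-negative function $w$ on $\mathbb{R}^n$ is called a dyadic $A_1$ weight if there is a constant $c\ge 1$ such that $$\frac{1}{|Q|}\int_Q w(y)\,dy\le c\,\operatorname{ess\,inf}_{x\in Q}w(x)$$ for every dyadic cube $Q$ in $\mathbb{R}^n$. Equivalently, $\mathcal{M}_d w(x)\le c\,w(x)$ for almost all $x\in\mathbb{R}^n$, where $\mathcal{M}_d w(x)=\sup\{\frac{1}{|Q|}\int_Q w(y)\,dy : x\in Q,\ Q\subset\mathbb{R}^n \text{ a dyadic cube}\}$. The smallest $c\ge 1$ for which this holds is the dyadic $A_1$ constant of $w$, denoted $[w]^d_1$. For a non-negative measurable function $v$ on a dyadic cube $Q$, its non-increasing rearrangement is $v^\ast(t)=\sup_{e\subseteq Q,\ |e|\ge t}\ \inf_{x\in e}v(x)$ for $t\in(0,|Q|]$, where the supremum is over measurable sets $e\subseteq Q$ with $|e|\ge t$. *)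

(* Defs.v *)
From HB Require Import structures.
From mathcomp Require Import all_boot all_order all_algebra.
From mathcomp Require Import all_classical all_reals all_analysis.
From mathcomp Require Import ess_sup_inf.

Set Implicit Arguments.
Unset Strict Implicit.
Unset Printing Implicit Defensive.

Import Order.TTheory GRing.Theory Num.Theory.
Import numFieldNormedType.Exports.

Local Open Scope classical_set_scope.
Local Open Scope ring_scope.

Section boxes.
Context (R : realType) (n : nat).
Implicit Types a b : 'rV[R]_n.

Definition box a b : set 'rV[R]_n :=
  [set x | forall i, x ord0 i \in `[a ord0 i, b ord0 i[].

Definition box_volume a b : R := \prod_(i < n) Num.max 0 (b ord0 i - a ord0 i).

Lemma box_volume_ge0 a b : 0 <= box_volume a b.
Proof. by apply: prodr_ge0 => i _; rewrite le_max lexx. Qed.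

End boxes.

(* Lebesgue outer measure on R^n. The predicate P lets the covering family be
   finite or empty: for n = 0 the only box is the whole space, of volume 1. *)
Section lebesgue_outer_measure.
Context (R : realType) (n : nat).
Local Open Scope ereal_scope.
Implicit Type X : set 'rV[R]_n.

Definition lebesgue_outer X : \bar R := ereal_inf [set s |
  exists (P : pred nat) (a b : nat -> 'rV[R]_n),
    X `<=` \bigcup_(k in [set k | P k]) box (a k) (b k) /\
    s = \sum_(k <oo | P k) (box_volume (a k) (b k))%:E].

Let vol P (a b : nat -> 'rV[R]_n) (k : nat) : \bar R :=
  if P k then (box_volume (a k) (b k))%:E else 0.

Let vol_ge0 P a b k : 0 <= vol P a b k.
Proof. by rewrite /vol; case: ifP => // _; rewrite lee_fin box_volume_ge0. Qed.

Let volE (P : pred nat) a b :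
  \sum_(k <oo | P k) (box_volume (a k) (b k))%:E = \sum_(k <oo) vol P a b k.
Proof. by rewrite eseries_mkcond. Qed.

Let lebesgue_outer_ge0 X : 0 <= lebesgue_outer X.
Proof.
apply: le_ereal_inf_tmp => _ [P [a [b [_ ->]]]]; rewrite volE.
by apply: nneseries_ge0 => *; exact: vol_ge0.
Qed.

Let lebesgue_outer0 : lebesgue_outer set0 = 0.
Proof.
apply/eqP; rewrite eq_le lebesgue_outer_ge0 andbT.
apply: ereal_inf_lbound; exists xpred0, (fun=> 0%R), (fun=> 0%R).
by split=> //; rewrite eseries0.
Qed.

Let le_lebesgue_outer : {homo lebesgue_outer : X Y / X `<=` Y >-> X <= Y}.
Proof.
move=> X Y XY; apply/ereal_inf_le_tmp => _ [P [a [b [Yab ->]]]].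
by exists P, a, b; split=> //; exact: subset_trans Yab.
Qed.

Let lebesgue_outer_sigma_subadditive : sigma_subadditive lebesgue_outer.
Proof.
move=> A; have [[i ioo]|] := pselect (exists i, lebesgue_outer (A i) = +oo).
  rewrite (eseries_pinfty _ _ ioo) ?leey// => k _.
  by rewrite -ltNye (lt_le_trans _ (lebesgue_outer_ge0 _)).
rewrite -forallNE => Aoo.
suff add2e (e : {posnum R}) : lebesgue_outer (\bigcup_k A k) <=
    \sum_(i <oo) lebesgue_outer (A i) + e%:num%:E.
  by apply/lee_addgt0Pr => _/posnumP[].
rewrite (le_trans _ (epsilon_trick _ _ _))//.
pose good i (G : pred nat * ((nat -> 'rV[R]_n) * (nat -> 'rV[R]_n))) :=
  A i `<=` \bigcup_(k in [set k | G.1 k]) box (G.2.1 k) (G.2.2 k) /\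
  \sum_(k <oo) vol G.1 G.2.1 G.2.2 k <=
    lebesgue_outer (A i) + (e%:num / (2 ^ i.+1)%:R)%:E.
have [G PG] : {G & forall i, good i (G i)}.
  apply: (@choice _ _ good) => i.
  have Ai : lebesgue_outer (A i) \is a fin_num.
    by rewrite ge0_fin_numE// ltey; exact/eqP/Aoo.
  have ei : (0 < e%:num / (2 ^ i.+1)%:R)%R by [].
  have [_ [P [a [b [AiPab ->]]]] lt_ab] := lb_ereal_inf_adherent ei Ai.
  by exists (P, (a, b)); split => //; rewrite -volE; exact/ltW.
pose F (p : nat * nat) := vol (G p.1).1 (G p.1).2.1 (G p.1).2.2 p.2.
have F_ge0 p : 0 <= F p by exact: vol_ge0.
apply: (@le_trans _ _ (\esum_(p in setT) F p)).
  have /card_esym/ppcard_eqP[f] := card_nat2.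
  apply: ereal_inf_lbound; exists (fun k => (G (f k).1).1 (f k).2),
    (fun k => (G (f k).1).2.1 (f k).2), (fun k => (G (f k).1).2.2 (f k).2).
  split=> [x [i _] /(PG i).1[j /= Gij xij]|].
    by exists (f^-1%FUN (i, j)); rewrite /= invK ?inE.
  rewrite volE -[RHS](_ : \sum_(k <oo) (F \o f) k = _)//.
  rewrite -(esum_pred_image F _ xpredT) ?[fun=> _]set_true//.
  congr esum; apply/seteqP; split=> // p _; exists (f^-1%FUN p) => //.
  by rewrite invK ?inE.
rewrite (_ : esum _ _ = \sum_(i <oo) \sum_(j <oo) F (i, j)); last first.
  pose J : nat -> set (nat * nat) := fun i => [set (i, j) | j in setT].
  rewrite (_ : setT = \bigcup_k J k); last first.
    by rewrite predeqE => -[a b]; split => // _; exists a => //; exists b.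
  rewrite esum_bigcupT //=; last first.
    apply/trivIsetP => i j _ _ ij.
    rewrite predeqE => -[p q] /=; split => //= -[] [_] _ [<-{p} _].
    by move=> [m' _] [] /esym/eqP; rewrite (negbTE ij).
  rewrite -(image_id [set: nat]) -fun_true esum_pred_image//; last first.
    by move=> *; exact: esum_ge0.
  apply: eq_eseriesr => /= j _.
  rewrite -(esum_pred_image F (pair j) predT)//=; last first.
    by move=> ? ? _ _; exact: (@can_inj _ _ _ snd).
  by congr esum; rewrite predeqE => -[a b]; split; move=> [i _ <-]; exists i.
apply: lee_nneseries => [i *|i _]; last exact: (PG i).2.
by apply: nneseries_ge0 => *; exact: vol_ge0.
Qed.

HB.instance Definition _ := isOuterMeasure.Build R 'rV[R]_n lebesgue_outer
  lebesgue_outer0 lebesgue_outer_ge0 le_lebesgue_outer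
  lebesgue_outer_sigma_subadditive.

End lebesgue_outer_measure.

(* R^n with the sigma-algebra of Lebesgue (not merely Borel) measurable sets. *)
Notation Rn R n := (caratheodory_type (@lebesgue_outer R n)).

Definition lebesgue_measure_Rn (R : realType) (n : nat) :
  set (Rn R n) -> \bar R := @lebesgue_outer R n.

HB.instance Definition _ (R : realType) (n : nat) :=
  isMeasure.Build _ _ _ (@lebesgue_measure_Rn R n)
    (@caratheodory_measure0 _ _ (@lebesgue_outer R n))
    (@caratheodory_measure_ge0 _ _ (@lebesgue_outer R n))
    (@caratheodory_measure_sigma_additive _ _ (@lebesgue_outer R n)).

Section dyadic_A1.
Context (R : realType) (n : nat).
Local Open Scope ereal_scope.
Local Notation mu := (@lebesgue_measure_Rn R n).
Implicit Types (w : Rn R n -> R) (Q : set (Rn R n)) (c : R).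

Definition dyadic_cube Q := exists (m : int) (k : 'rV[int]_n),
  Q = box (\row_i ((k ord0 i)%:~R * 2 ^ m))%R
          (\row_i ((k ord0 i + 1)%:~R * 2 ^ m))%R.

Definition locally_integrable_Rn w := measurable_fun [set: Rn R n] w /\
  forall K : set 'rV[R]_n, compact K -> \int[mu]_(x in K) `|w x|%:E < +oo.

Definition average Q w : \bar R :=
  ((fine (mu Q))^-1)%:E * \int[mu]_(y in Q) (w y)%:E.

(* Setting the function to +oo off Q leaves only its values on Q. *)
Definition ess_inf_on Q w : \bar R :=
  ess_inf mu (patch (cst +oo) Q (EFin \o w)).

Definition dyadic_A1_bound w c := (1 <= c)%R /\
  forall Q, dyadic_cube Q -> average Q w <= c%:E * ess_inf_on Q w.

Definition dyadic_A1_weight w := [/\ locally_integrable_Rn w,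
  forall x, (0 <= w x)%R & exists c, dyadic_A1_bound w c].

Definition is_dyadic_A1_constant w c := dyadic_A1_bound w c /\
  forall c', dyadic_A1_bound w c' -> (c <= c')%R.

Definition rearrangement Q w (t : R) : \bar R :=
  ereal_sup [set ereal_inf [set (w x)%:E | x in e] |
    e in [set e | [/\ measurable e, e `<=` Q & t%:E <= mu e]]].

Definition rearrangement_bound Q w (C : R) := forall t : R,
  (0 < t)%R -> t%:E <= mu Q ->
  (t^-1)%:E * \int[lebesgue_measure]_(y in `]0%R, t]) rearrangement Q w y
    <= C%:E * rearrangement Q w t.

End dyadic_A1.

(* Main.v *)
Require Import Defs.
From mathcomp Require Import all_boot all_order all_algebra.
From mathcomp Require Import all_classical all_reals all_analysis.
From mathcomp Require Import measurable_realfun ess_sup_inf zify ring lra.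
Import Order.TTheory GRing.Theory Num.Theory.
Import numFieldNormedType.Exports.

(** The inequality bounds the mean of the rearrangement w* of w over (0, t].
    Put lam = w*(t), E = {x in Q : w x > lam} and h = max(0, w - lam).

    Each superlevel set of w* is an interval whose length is at most the measure
    of the superlevel set of w at the same level.  Hence the integral of w* over
    (0, t] is at most lam t plus the integral of h over Q
    [integral_rearrangement_le]; moreover |E| <= t
    [measure_superlevel_rearrangement].  So it is enough that the integral of h
    over Q is at most (c - 1) lam 2^n |E|  [excess_le_superlevel].

    On a single dyadic cube I whose essential infimum r is at most lam, the A1
    condition says that w has mean at most c r, and h + r <= w almost everywhere;
    hence the integral of h over I is at most (c - 1) r |I| <= (c - 1) lam |I|
    [excess_le].  The cube Q is of this kind [ess_inf_on_le_rearrangement].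
    Descend from Q through the dyadic subcubes as long as they are of this kind,
    down to a fixed side 2^j.  A subcube that is not of this kind lies almost
    everywhere in E, and then its parent P satisfies |P| <= 2^n |P /\ E|, so that
    the bound (c - 1) lam |P| is good enough on P; this is where 2^n enters.
    The cubes of side 2^j reached without meeting such a subcube are kept only if
    they lie in an open set O containing E with |O| <= |E| + eps: together they
    exceed their part of E by at most eps.  This is an induction over the levels of
    the dyadic tree [excess_tree_le].  The kept cubes exhaust O as j tends to
    minus infinity, and then eps tends to 0.

    For the sharpness, let w be K = 2^n (c - 1) + 1 on one dyadic child I of Q and 1
    elsewhere.  Its A1 constant is the mean c over Q.  For t slightly larger than
    |I|, w*(t) = 1 while the mean of w* over (0, t] is close to K.

    Both parts rest on the measure of a box being its volume
    [lebesgue_outer_box] and on outer regularity [lebesgue_outer_regular]. *)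

Set Implicit Arguments.
Unset Strict Implicit.
Unset Printing Implicit Defensive.
Local Open Scope classical_set_scope.
Local Open Scope ring_scope.

(** * Boxes are measurable and their measure is their volume *)

Section boxes_measure.
Context (R : realType).
Local Open Scope ereal_scope.

Definition set_coord n (a : 'rV[R]_n) (i : 'I_n) (r : R) : 'rV[R]_n :=
  (\row_j if j == i then r else a ord0 j)%R.

Lemma box_volume_split n (a b : 'rV[R]_n) (i : 'I_n) (r : R) :
  (box_volume a (set_coord b i (Num.min (b ord0 i) r)) +
   box_volume (set_coord a i (Num.max (a ord0 i) r)) b = box_volume a b)%R.
Proof.
rewrite /box_volume (bigD1 i)//= [X in (_ + X)%R](bigD1 i)//= [RHS](bigD1 i)//=.
rewrite !mxE eqxx.
rewrite (eq_bigr (fun j => Num.max 0 (b ord0 j - a ord0 j))%R); last first.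
  by move=> j ji; rewrite mxE (negbTE ji).
rewrite [X in (_ + _ * X)%R](eq_bigr (fun j => Num.max 0 (b ord0 j - a ord0 j))%R).
  rewrite -mulrDl; congr (_ * _)%R.
  by rewrite /Num.max /Num.min; repeat case: ifPn; lra.
by move=> j ji; rewrite mxE (negbTE ji).
Qed.

Lemma box_set_coordr n (a b : 'rV[R]_n) i r :
  box a b `&` [set x | (x ord0 i < r)%R] `<=`
  box a (set_coord b i (Num.min (b ord0 i) r)).
Proof.
move=> x [xab xr] j; rewrite mxE; case: eqP => [->|_]; last exact: xab.
by have := xab i; rewrite !in_itv/= lt_min => /andP[-> ->].
Qed.

Lemma box_set_coordl n (a b : 'rV[R]_n) i r :
  box a b `&` ~` [set x | (x ord0 i < r)%R] `<=`
  box (set_coord a i (Num.max (a ord0 i) r)) b.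
Proof.
move=> x [xab /negP]; rewrite -leNgt => xr j; rewrite mxE.
case: eqP => [->|_]; last exact: xab.
by have := xab i; rewrite !in_itv/= ge_max => /andP[-> ->]; rewrite xr.
Qed.

(** A half-space cuts each box of a cover into two boxes whose volumes add up
    to that of the box, so Caratheodory's condition holds cover by cover. *)
Lemma halfspace_measurable n (i : 'I_n) (r : R) :
  measurable ([set x | (x ord0 i < r)%R] : set (Rn R n)).
Proof.
apply: le_caratheodory_measurable => X; apply: le_ereal_inf_tmp => _ [P [a [b [Xab ->]]]].
pose b' k := set_coord (b k) i (Num.min (b k ord0 i) r).
pose a' k := set_coord (a k) i (Num.max (a k ord0 i) r).
apply: (@le_trans _ _ (\sum_(k <oo | P k) (box_volume (a k) (b' k))%:E +
                       \sum_(k <oo | P k) (box_volume (a' k) (b k))%:E)).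
  apply: leeD; apply: ereal_inf_lbound.
    exists P, a, b'; split=> // x [/Xab[k Pk xk] xr]; exists k => //.
    exact: box_set_coordr.
  exists P, a', b; split=> // x [/Xab[k Pk xk] xr]; exists k => //.
  exact: box_set_coordl.
rewrite -nneseriesD//; try by move=> *; rewrite lee_fin box_volume_ge0.
apply: lee_nneseries => k *; first by rewrite adde_ge0// lee_fin box_volume_ge0.
by rewrite -EFinD box_volume_split.
Qed.

Lemma box_measurable n (a b : 'rV[R]_n) : measurable (box a b : set (Rn R n)).
Proof.
pose H (i : 'I_n) (r : R) : set (Rn R n) := [set x | (x ord0 i < r)%R].
have -> : box a b = \bigcap_(i in [set: 'I_n])
    (~` H i (a ord0 i) `&` H i (b ord0 i)).
  apply/seteqP; split=> [x xab i _|x xab i].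
    by have /= := xab i; rewrite in_itv/= /H/= => /andP[ax xb]; split; [apply/negP; rewrite -leNgt|].
  by have [/negP] := xab i I; rewrite -leNgt in_itv/= => -> ->.
apply: fin_bigcap_measurable => [|i _]; first exact: finite_finset.
apply: measurableI; first apply: measurableC; exact: halfspace_measurable.
Qed.

Definition row_tail n (a : 'rV[R]_n.+1) : 'rV[R]_n := (\row_j a ord0 (lift ord0 j))%R.

Lemma box_volume_recl n (a b : 'rV[R]_n.+1) : box_volume a b =
  (Num.max 0 (b ord0 ord0 - a ord0 ord0) * box_volume (row_tail a) (row_tail b))%R.
Proof.
rewrite /box_volume big_ord_recl; congr (_ * _)%R.
by apply: eq_bigr => i _; rewrite !mxE.
Qed.

Lemma lebesgue_measure_itvco (a b : R) :
  lebesgue_measure (`[a, b[ : set R) = (Num.max 0 (b - a))%:E.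
Proof.
rewrite lebesgue_measure_itv/= lte_fin -EFinB; case: ltP => ab.
  by rewrite max_r// subr_ge0 ltW.
by rewrite max_l// subr_le0.
Qed.

(** Slicing: for each value x of the first coordinate, the slices of the boxes
    that contain x cover the slice of the big box, and integrating the
    inequality of one dimension less over x gives that of the next one. *)
Lemma box_volume_le_cover n (a b : 'rV[R]_n) (P : pred nat) (A B : nat -> 'rV[R]_n) :
  box a b `<=` \bigcup_(k in [set k | P k]) box (A k) (B k) ->
  (box_volume a b)%:E <= \sum_(k <oo | P k) (box_volume (A k) (B k))%:E.
Proof.
elim: n a b P A B => [|n IHn] a b P A B abAB.
  have [k /= Pk _] : (\bigcup_(k in [set k | P k]) box (A k) (B k)) a.
    by apply: abAB => -[].
  rewrite (nneseriesD1 _ Pk); last by move=> *; rewrite lee_fin box_volume_ge0.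
  rewrite /box_volume big_ord0 [X in X%:E + _]big_ord0 leeDl//.
  by apply: nneseries_ge0 => *; rewrite lee_fin prodr_ge0// => ? _; rewrite le_max lexx.
rewrite box_volume_recl EFinM -lebesgue_measure_itvco.
set D : set R := `[_, _[%classic.
have mD : measurable D by exact: measurable_itv.
pose I k : set R := `[A k ord0 ord0, B k ord0 ord0[%classic.
have mI k : measurable (I k) by exact: measurable_itv.
pose v k := (if P k then box_volume (row_tail (A k)) (row_tail (B k)) else 0)%R.
have v0 k : (0 <= v k)%R by rewrite /v; case: ifP => // _; exact: box_volume_ge0.
have mI1 k (E : set R) : measurable_fun E (fun x : R => (\1_(I k) x)%:E).
  by apply/measurable_EFinP; apply: measurable_funTS; exact: measurable_indic.
have mvI k (E : set R) : measurable_fun E (fun x : R => ((v k)%:E * (\1_(I k) x)%:E : \bar R)).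
  by apply: measurable_funeM; exact: mI1.
apply: (@le_trans _ _ (\int[lebesgue_measure]_(x in D)
    \sum_(k <oo) ((v k)%:E * (\1_(I k) x)%:E))).
  rewrite muleC -integral_cst//; apply: ge0_le_integral => //.
  - by move=> x _; rewrite lee_fin box_volume_ge0.
  - rewrite (_ : (fun x => _) = (fun x => \sum_(k <oo | k \in xpredT) ((v k)%:E * (\1_(I k) x)%:E))).
      by apply: ge0_emeasurable_sum => [k x *|k _]; [rewrite mule_ge0// lee_fin|exact: mvI].
    by apply/funext => x; apply: eq_eseriesl.
  - move=> x Dx; pose P' k := P k && (x \in I k).
    have /IHn/le_trans : box (row_tail a) (row_tail b) `<=`
        \bigcup_(k in [set k | P' k]) box (row_tail (A k)) (row_tail (B k)).
      move=> y yab.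
      pose z : 'rV[R]_n.+1 := (\row_i if unlift ord0 i is Some j then y ord0 j else x)%R.
      have z0 : z ord0 ord0 = x by rewrite mxE unlift_none.
      have zS j : z ord0 (lift ord0 j) = y ord0 j by rewrite mxE liftK.
      have /abAB[k /= Pk zk] : box a b z.
        move=> i; case: (unliftP ord0 i) => [j|] ->; last by rewrite z0.
        by rewrite zS; have := yab j; rewrite !mxE.
      exists k; first by rewrite /= /P' Pk inE/= /I/=; have := zk ord0; rewrite z0.
      by move=> j; have := zk (lift ord0 j); rewrite zS !mxE.
    apply; rewrite eseries_mkcond; apply: lee_nneseries => k _.
      by move=> _; case: ifP => // _; rewrite lee_fin box_volume_ge0.
    rewrite /P' /v indicE; case: ifP => [/andP[-> ->]|]; first by rewrite mule1.
    by move=> _; rewrite mule_ge0// lee_fin//; case: ifP => // _; exact: box_volume_ge0.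
rewrite integral_nneseries//; last 2 first.
- by move=> k; exact: mvI.
- by move=> k x _; rewrite mule_ge0// lee_fin.
rewrite [leRHS]eseries_mkcond; apply: lee_nneseries => k _.
  by move=> _; apply: integral_ge0 => x _; rewrite mule_ge0// lee_fin.
rewrite ge0_integralZl_EFin//; last first.
  exact: mI1.
rewrite integral_indic//; last exact: mI.
rewrite /v; case: ifP => _; last by rewrite mul0e.
rewrite box_volume_recl EFinM -lebesgue_measure_itvco muleC.
apply: lee_wpmul2r; first by rewrite lee_fin box_volume_ge0.
apply: le_measure; last exact: subIsetl; rewrite inE; last exact: mI.
by apply: measurableI; [exact: mI|exact: mD].
Qed.

Lemma lebesgue_outer_box n (a b : 'rV[R]_n) :
  lebesgue_outer (box a b) = (box_volume a b)%:E.
Proof.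
apply/eqP; rewrite eq_le; apply/andP; split.
  apply: ereal_inf_lbound; exists (pred1 0%N), (fun=> a), (fun=> b); split.
    by move=> x xab; exists 0%N => //=.
  rewrite eseries_mkcond (nneseries_split 0%N 1%N); last first.
    by move=> k _; case: ifP => // _; rewrite lee_fin box_volume_ge0.
  by rewrite big_nat1/= eseries0 ?adde0// => -[].
by apply: le_ereal_inf_tmp => _ [P [A [B [abAB ->]]]]; exact: box_volume_le_cover.
Qed.

End boxes_measure.

(** * The dyadic grid *)

Section dyadic_grid.
Context (R : realType) (n : nat).
Implicit Types (m : int) (k : 'rV[int]_n) (x y : 'rV[R]_n).
Local Notation mu := (@lebesgue_measure_Rn R n).

Definition grid_cube m k : set 'rV[R]_n :=
  box (\row_i ((k ord0 i)%:~R * 2 ^ m)) (\row_i ((k ord0 i + 1)%:~R * 2 ^ m)).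

(** Cubes of side 2^m are the fibres of this map, which turns their nesting and
    disjointness into statements about integer parts. *)
Definition grid_index m x : 'rV[int]_n := \row_i Num.floor (x ord0 i / 2 ^ m).

Lemma exp2z_gt0 m : 0 < 2 ^ m :> R.
Proof. by rewrite exprz_gt0. Qed.

Lemma exp2z_half m : 2 ^ m = 2 * 2 ^ (m - 1) :> R.
Proof. by rewrite expfzDr// exprN1 mulrCA mulfV// mulr1. Qed.

Lemma grid_cubeE m k x : grid_cube m k x <-> grid_index m x = k.
Proof.
have p0 := exp2z_gt0 m; split=> [xk|<-].
  apply/rowP => i; rewrite mxE; apply/eqP; rewrite floor_eq.
  by have := xk i; rewrite in_itv/= !mxE -ler_pdivlMr// -ltr_pdivrMr.
move=> i; rewrite in_itv/= !mxE -ler_pdivlMr// -ltr_pdivrMr//.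
exact: floor_itv.
Qed.

Lemma grid_cube_index m x : grid_cube m (grid_index m x) x.
Proof. exact/grid_cubeE. Qed.

Lemma grid_cube_measurable m k : measurable (grid_cube m k : set (Rn R n)).
Proof. exact: box_measurable. Qed.

Lemma grid_cube_nonempty m k : grid_cube m k !=set0.
Proof.
exists (\row_i ((k ord0 i)%:~R * 2 ^ m)) => i; have p0 := exp2z_gt0 m.
by rewrite in_itv/= !mxE lexx/= ltr_pM2r// ltr_int ltzD1.
Qed.

Lemma grid_cube_volume m k : mu (grid_cube m k) = ((2 ^ m) ^+ n)%:E.
Proof.
rewrite /lebesgue_measure_Rn /= lebesgue_outer_box; congr EFin.
rewrite /box_volume (eq_bigr (fun=> 2 ^ m)) ?prodr_const ?card_ord// => i _.
rewrite !mxE -mulrBl -intrB addrAC subrr add0r mul1r max_r//.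
exact/ltW/exp2z_gt0.
Qed.

Definition grid_child k (e : {ffun 'I_n -> bool}) : 'rV[int]_n :=
  \row_i (2 * k ord0 i + e i).

Lemma grid_child_inj k : injective (grid_child k).
Proof.
move=> e f /rowP ef; apply/ffunP => i.
by have := ef i; rewrite !mxE => /addrI; case: (e i); case: (f i).
Qed.

Lemma grid_cube_children m k : grid_cube m k =
  \bigcup_(e in [set: {ffun 'I_n -> bool}]) grid_cube (m - 1) (grid_child k e).
Proof.
have p0 := exp2z_gt0 (m - 1).
apply/seteqP; split=> [x xk|x [e _ xe] i].
  exists [ffun i => (2 * k ord0 i + 1)%:~R * 2 ^ (m - 1) <= x ord0 i] => // i.
  have := xk i; rewrite !in_itv/= !mxE ffunE (exp2z_half m).
  rewrite !intrD !intrM; set K : R := (k ord0 i)%:~R; set p : R := 2 ^ (m - 1) in p0 *.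
  by case: (leP ((2%:~R * K + 1%:~R) * p)) => /= h /andP[h1 h2]; apply/andP; split; lra.
have := xe i; rewrite !in_itv/= !mxE (exp2z_half m).
rewrite !intrD !intrM; set K : R := (k ord0 i)%:~R; set p : R := 2 ^ (m - 1) in p0 *.
by case: (e i) => /= /andP[h1 h2]; apply/andP; split; lra.
Qed.

Lemma grid_child_trivIset m k (D : set {ffun 'I_n -> bool}) :
  trivIset D (fun e => grid_cube (m - 1) (grid_child k e)).
Proof.
move=> e f _ _ [x [/grid_cubeE xe /grid_cubeE xf]].
by apply: (@grid_child_inj k); rewrite -xe -xf.
Qed.

Lemma grid_cube_child_volume m k e :
  mu (grid_cube m k) = ((2 ^+ n)%:E * mu (grid_cube (m - 1) (grid_child k e)))%E.
Proof. by rewrite !grid_cube_volume (exp2z_half m) exprMn EFinM. Qed.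

Lemma ge0_integral_children m k (V : set (Rn R n)) (f : Rn R n -> \bar R) :
  measurable V -> measurable_fun [set: Rn R n] f -> (forall x, 0 <= f x)%E ->
  (\int[mu]_(x in grid_cube m k `&` V) f x =
   \sum_(e : {ffun 'I_n -> bool})
     \int[mu]_(x in grid_cube (m - 1) (grid_child k e) `&` V) f x)%E.
Proof.
move=> mV mf f0; rewrite -(@ge0_integral_bigsetU _ _ _ mu _
    (fun e => grid_cube (m - 1) (grid_child k e) `&` V))//.
- congr integral; rewrite grid_cube_children setI_bigcupl -bigcup_seq.
  rewrite (_ : [set` _] = setT)//; apply/seteqP; split=> e //= _.
  exact: mem_index_enum.
- by move=> e; apply: measurableI => //; exact: grid_cube_measurable.
- exact: index_enum_uniq.
- by apply: trivIset_setIr; exact: grid_child_trivIset.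
- exact: measurable_funTS.
Qed.

(** The union of the cubes of side 2^m contained in O.  A point of an open O has its
    whole cube inside O as soon as m is small enough, so that these unions exhaust
    O. *)
Definition grid_interior m (O : set 'rV[R]_n) : set 'rV[R]_n :=
  [set x | grid_cube m (grid_index m x) `<=` O].

Lemma grid_interior_sub m O : grid_interior m O `<=` O.
Proof. by move=> x; apply; exact: grid_cube_index. Qed.

Lemma grid_interior_measurable m O :
  measurable (grid_interior m O : set (Rn R n)).
Proof.
rewrite (_ : grid_interior m O =
    \bigcup_k (if `[< grid_cube m k `<=` O >] then grid_cube m k else set0)).
  apply: countable_bigcupT_measurable; first exact: countableP.
  by move=> k; case: ifP => // _; exact: grid_cube_measurable.
apply/seteqP; split=> x.
  move=> xO; exists (grid_index m x) => //.
  by rewrite asboolT//; exact: grid_cube_index.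
by move=> [k _]; case: ifPn => // /asboolP kO /grid_cubeE; rewrite /grid_interior/= => ->.
Qed.

Lemma grid_interior_dichotomy m k O :
  grid_cube m k `<=` grid_interior m O \/ grid_cube m k `&` grid_interior m O = set0.
Proof.
have [kO|kO] := pselect (grid_cube m k `<=` O); [left|right].
  by move=> x /grid_cubeE xk; rewrite /grid_interior/= xk.
by rewrite -subset0 => x [/grid_cubeE xk]; rewrite /grid_interior/= xk.
Qed.

Lemma grid_interior_refine m O : grid_interior m O `<=` grid_interior (m - 1) O.
Proof.
move=> x; apply: subset_trans; move: (grid_cube_index m x).
rewrite {1}grid_cube_children => -[e _ /grid_cubeE ->].
by rewrite [X in _ `<=` X]grid_cube_children => y ye; exists e.
Qed.

Lemma exp2z_small m (d : R) : 0 < d -> exists N : nat, 2 ^ (m - N%:Z) < d.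
Proof.
move=> d0; have p0 := exp2z_gt0 m.
exists (Num.truncn (2 ^ m / d)).+1; set N := (Num.truncn _).+1.
rewrite expfzDr// -exprnN ltr_pdivrMr ?exprn_gt0// mulrC -ltr_pdivrMr//.
have : 2 ^ m / d < N%:R by exact: truncnS_gt.
by move/lt_trans; apply; rewrite -natrX ltr_nat ltn_expl.
Qed.

Lemma grid_interior_open m (O : set 'rV[R]_n) : open O ->
  \bigcup_(N in [set: nat]) grid_interior (m - N%:Z) O = O.
Proof.
move=> oO; apply/seteqP; split=> [x [N _]|x]; first exact: grid_interior_sub.
move=> Ox; have /nbhs_ballP[d /= d0 dO] : nbhs x O by exact: open_nbhs_nbhs.
have [N Nd] := exp2z_small m d0; exists N => // y /grid_cubeE/esym xy.
apply: dO; split=> // i j; rewrite (ord1 i).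
have := grid_cube_index (m - N%:Z) x; have := grid_cube_index (m - N%:Z) y.
rewrite -xy => /(_ j) + /(_ j); rewrite !in_itv/= !mxE intrD mulrDl mul1r.
rewrite /ball/= => /andP[? ?] /andP[? ?].
by rewrite ltr_norml; apply/andP; split; lra.
Qed.

Lemma grid_interior_nondecreasing m (O : set 'rV[R]_n) :
  nondecreasing_seq (fun N : nat => grid_interior (m - N%:Z) O).
Proof.
apply/nondecreasing_seqP => N; rewrite subsetEset.
have -> : m - N.+1%:Z = m - N%:Z - 1 by rewrite -addn1 PoszD opprD addrA.
exact: grid_interior_refine.
Qed.

Lemma open_measurable_Rn (O : set 'rV[R]_n) : open O ->
  measurable (O : set (Rn R n)).
Proof.
move=> /(grid_interior_open 0) <-.
by apply: bigcupT_measurable => N; exact: grid_interior_measurable.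
Qed.

Lemma closed_measurable_Rn (K : set 'rV[R]_n) : closed K ->
  measurable (K : set (Rn R n)).
Proof.
move=> /closed_openC/open_measurable_Rn/measurableC.
by rewrite setCK.
Qed.

End dyadic_grid.

(** * Outer regularity and local integrability *)

Section outer_regularity.
Context (R : realType) (n : nat).
Local Notation mu := (@lebesgue_measure_Rn R n).

Lemma box_nbhs (a b x : 'rV[R]_n) :
  (forall i, a ord0 i < x ord0 i < b ord0 i) -> nbhs x (box a b).
Proof.
move=> axb; exists (fun _ j => `]a ord0 j, b ord0 j[%classic).
  by move=> i j; rewrite (ord1 i); apply: near_in_itvoo; rewrite in_itv/= axb.
move=> y yab i; have := yab ord0 i; rewrite /= !in_itv/= => /andP[/ltW -> ->].
by [].
Qed.

Lemma box_volume_enlarge (a b : 'rV[R]_n) (e : R) : 0 < e ->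
  exists2 d, 0 < d & box_volume (\row_i (a ord0 i - d)) b <= box_volume a b + e.
Proof.
move=> e0.
pose f (d : R) := \prod_(i < n) Num.max 0 (b ord0 i - (a ord0 i - d)).
have cf : f d @[d --> 0] --> f 0.
  apply: cvg_big => [|i _]; first exact: mul_continuous.
  pose g (d : R) : R^o := b ord0 i - (a ord0 i - d).
  apply: (@continuous_max R R (fun=> 0) g 0); first exact: cvg_cst.
  rewrite /continuous_at /g; apply: cvgB; first exact: cvg_cst.
  by apply: cvgB; [exact: cvg_cst|exact: cvg_id].
have f0 : f 0 = box_volume a b by apply: eq_bigr => i _; rewrite subr0.
have : \forall d \near (0 : R), f d < box_volume a b + e.
  by apply: (cvgr_lt (f 0) cf); rewrite f0 ltrDl.
move=> /nbhs_ballP[r /= r0 rf]; exists (r / 2); first by rewrite divr_gt0.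
apply/ltW; have := rf (r / 2); rewrite /ball/= sub0r normrN gtr0_norm ?divr_gt0//.
rewrite ltr_pdivrMr// ltr_pMr// ltr1n => /(_ isT).
by rewrite /f/box_volume; under [X in _ -> X < _]eq_bigr do rewrite mxE.
Qed.

(** The half-open boxes of a nearly optimal cover, enlarged a little on their
    closed sides, contain the set in the interior of their union. *)
Lemma lebesgue_outer_regular (E : set 'rV[R]_n) (e : R) : 0 < e ->
  (lebesgue_outer E < +oo)%E -> exists O : set 'rV[R]_n,
  [/\ open O, E `<=` O & (lebesgue_outer O <= lebesgue_outer E + e%:E)%E].
Proof.
move=> e0 Eoo.
have Efin : lebesgue_outer E \is a fin_num by rewrite ge0_fin_numE// outer_measure_ge0.
have e20 : 0 < e / 2 by rewrite divr_gt0.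
have [_ [P [a [b [EPab ->]]]] lt_ab] := lb_ereal_inf_adherent e20 Efin.
have [d dP] : {d : nat -> R & forall k, 0 < d k /\
    box_volume (\row_i (a k ord0 i - d k)) (b k) <=
    box_volume (a k) (b k) + e / 2 / (2 ^ k.+1)%:R}.
  apply: (@choice _ _ (fun k d => 0 < d /\
    box_volume (\row_i (a k ord0 i - d)) (b k) <=
    box_volume (a k) (b k) + e / 2 / (2 ^ k.+1)%:R)) => k.
  have ek : 0 < e / 2 / (2 ^ k.+1)%:R by rewrite divr_gt0// ltr0n expn_gt0.
  by have [d ? ?] := box_volume_enlarge (a k) (b k) ek; exists d.
pose a' k : 'rV[R]_n := \row_i (a k ord0 i - d k).
exists (\bigcup_(k in [set k | P k]) box (a' k) (b k))°; split.
- exact: open_interior.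
- move=> x /EPab[k Pk xk]; apply: filterS (@box_nbhs (a' k) (b k) x _).
    by move=> y yk; exists k.
  move=> i; rewrite !mxE; have := xk i; rewrite in_itv/= => /andP[ax ->].
  by rewrite andbT (lt_le_trans _ ax)// ltrBlDr ltrDl (dP k).1.
- apply: (@le_trans _ _ (\sum_(k <oo | P k) (box_volume (a' k) (b k))%:E)%E).
    apply: ereal_inf_lbound; exists P, a', b; split=> //.
    exact: interior_subset.
  apply: (@le_trans _ _ (\sum_(k <oo | P k) ((box_volume (a k) (b k))%:E +
      (e / 2 / (2 ^ k.+1)%:R)%:E))%E).
    apply: lee_nneseries => k; first by rewrite lee_fin box_volume_ge0.
    by rewrite -EFinD lee_fin (dP k).2.
  apply: le_trans (epsilon_trick P _ _) _.
  + by move=> k; rewrite lee_fin box_volume_ge0.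
  + exact: (ltW e20).
  + have -> : (e%:E = (e / 2)%:E + (e / 2)%:E)%E by rewrite -EFinD -splitr.
    rewrite addeA leeD2r//.
    exact: (ltW lt_ab).
Qed.

Lemma box_finite (a b : 'rV[R]_n) : (mu (box a b) < +oo)%E.
Proof. by rewrite /lebesgue_measure_Rn lebesgue_outer_box ltry. Qed.

Lemma compact_measurable_Rn (K : set 'rV[R]_n) : compact K ->
  measurable (K : set (Rn R n)).
Proof.
by move=> cK; apply: closed_measurable_Rn; apply: compact_closed => //; exact: norm_hausdorff.
Qed.

Lemma compact_sub_box (K : set 'rV[R]_n) : compact K ->
  exists a b : 'rV[R]_n, K `<=` box a b.
Proof.
move=> /compact_bounded[M [_ KM]].
exists (const_mx (- (M + 2))), (const_mx (M + 2)) => x Kx i.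
have xM : `|x| <= M + 1 by apply: KM => //; rewrite ltrDl.
have xi : `|x ord0 i| <= M + 1.
  apply: le_trans xM; rewrite [leRHS]/Num.norm/= mx_normrE.
  exact: (le_bigmax _ (fun ij : 'I_1 * 'I_n => `|x ij.1 ij.2|) (ord0, i)).
rewrite in_itv/= !mxE; move: xi; rewrite ler_norml => /andP[? ?].
by apply/andP; split; lra.
Qed.

Lemma locally_integrable_box (w : Rn R n -> R) (a b : 'rV[R]_n) :
  locally_integrable_Rn w -> (\int[mu]_(x in box a b) `|w x|%:E < +oo)%E.
Proof.
move=> [mw lw].
pose K : set 'rV[R]_n := [set x | forall i, `[a ord0 i, b ord0 i]%classic (x ord0 i)].
have cK : compact K.
  apply: (@rV_compact R n (fun i => `[a ord0 i, b ord0 i]%classic)) => i.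
  exact: segment_compact.
apply: le_lt_trans (lw _ cK); apply: ge0_subset_integral => //.
- exact: box_measurable.
- exact: compact_measurable_Rn.
- apply/measurable_EFinP; apply: measurable_funTS.
  exact: measurableT_comp.
- by move=> x xab i; have := xab i; rewrite /= !in_itv/= => /andP[-> /ltW].
Qed.

End outer_regularity.

(** * The excess over a level on dyadic cubes *)

Section stopping_cubes.
Context (R : realType) (n : nat).
Local Notation mu := (@lebesgue_measure_Rn R n).
Variables (w : Rn R n -> R) (c lam : R).
Hypotheses (mw : measurable_fun [set: Rn R n] w) (w0 : forall x, 0 <= w x).
Hypotheses (c1 : 1 <= c) (lam0 : 0 <= lam).
Hypothesis A1 : forall Q, dyadic_cube Q -> (average Q w <= c%:E * ess_inf_on Q w)%E.

Let E : set (Rn R n) := [set x | lam < w x].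
Let h (x : Rn R n) : \bar R := (Num.max 0 (w x - lam))%:E.

Let mE : measurable E.
Proof.
have -> : E = [set: Rn R n] `&` w @^-1` `]lam, +oo[%classic.
  by rewrite setTI; apply/seteqP; split=> x /=; rewrite /E/= in_itv/= andbT.
exact: mw.
Qed.

Let mh : measurable_fun [set: Rn R n] h.
Proof.
apply/measurable_EFinP; apply: measurable_maxr; first exact: measurable_cst.
by apply: measurable_funB => //; exact: measurable_cst.
Qed.

Let h0 x : (0 <= h x)%E.
Proof. by rewrite lee_fin le_max lexx. Qed.

Lemma ae_ge_ess_inf_on (I : set (Rn R n)) (r : R) : (r%:E <= ess_inf_on I w)%E ->
  {ae mu, forall x, I x -> r <= w x}.
Proof.
move=> /ess_infP; apply: filterS => x /[swap] Ix.
by rewrite patchT ?inE// lee_fin.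
Qed.

(** With r the essential infimum on I, almost everywhere on I
    h + r <= w, because either w > lam >= r or h = 0; integrating and comparing with
    the A1 bound c * r on the average of w leaves the excess c * r - r. *)
Lemma excess_le (m : int) (k : 'rV[int]_n) :
  (ess_inf_on (grid_cube m k) w <= lam%:E)%E ->
  (\int[mu]_(x in grid_cube m k) h x <= ((c - 1) * lam)%:E * mu (grid_cube m k))%E.
Proof.
set I : set (Rn R n) := grid_cube m k => infI.
have mI : measurable I by exact: grid_cube_measurable.
have v0 : 0 < (2 ^ m : R) ^+ n by rewrite exprn_gt0// exp2z_gt0.
have [r infE] : exists r : R, ess_inf_on I w = r%:E.
  have : (0%R%:E <= ess_inf_on I w)%E.
    apply/ess_infP; apply: nearW => x; rewrite /patch.
    by case: ifP => _; rewrite ?leey// lee_fin.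
  by case: (ess_inf_on I w) infI => // r _ _; exists r.
have rlam : r <= lam by rewrite -lee_fin -infE.
have r0 : 0 <= r.
  rewrite -lee_fin -infE; apply/ess_infP; apply: nearW => x; rewrite /patch.
  by case: ifP => _; rewrite ?leey// lee_fin.
have avgI : (\int[mu]_(x in I) (w x)%:E <= (c * r)%:E * mu I)%E.
  have /A1 : dyadic_cube I by exists m, k.
  rewrite /average infE -EFinM /I grid_cube_volume /= => H.
  rewrite -(@lee_pmul2l _ (((2 ^ m) ^+ n)^-1)%:E) ?lte_fin ?invr_gt0//.
  by apply: le_trans H _; rewrite -!EFinM lee_fin mulrCA mulVf ?gt_eqF// mulr1.
have hr : (\int[mu]_(x in I) h x + r%:E * mu I <= \int[mu]_(x in I) (w x)%:E)%E.
  rewrite -integral_cst// -ge0_integralD//; last exact: measurable_funTS.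
  apply: ae_ge0_le_integral => //.
  - by move=> x _; rewrite adde_ge0// lee_fin.
  - by apply: emeasurable_funD; [exact: measurable_funTS|exact: measurable_cst].
  - by move=> x _; rewrite lee_fin.
  - by apply/measurable_EFinP; exact: measurable_funTS.
  have : {ae mu, forall x, I x -> r <= w x} by apply: ae_ge_ess_inf_on; rewrite infE.
  apply: filterS => x + Ix => /(_ Ix) rw.
  by rewrite -EFinD lee_fin; rewrite /Num.max; case: ltP => ?; lra.
have muI : mu I = ((2 ^ m) ^+ n)%:E by exact: grid_cube_volume.
move: (le_trans hr avgI); rewrite muI -!EFinM -leeBrDr// -EFinB => /le_trans; apply.
rewrite lee_fin -mulrBl ler_pM2r//.
have -> : c * r - r = (c - 1) * r by rewrite mulrBl mul1r.
by rewrite ler_wpM2l// subr_ge0.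
Qed.

Lemma measure_superlevel_of_lt_ess_inf (I : set (Rn R n)) : measurable I ->
  (lam%:E < ess_inf_on I w)%E -> mu (I `&` E) = mu I.
Proof.
move=> mI lamI; apply/eqP; rewrite eq_le; apply/andP; split.
  by apply: le_measure; rewrite ?inE//; exact: measurableI.
have -> : mu I = (mu (I `\` E) + mu (I `&` E))%E by exact: measureDI.
rewrite (@measure_negligible _ _ _ mu (I `\` E)) ?add0e//; first exact: measurableD.
have : {ae mu, forall x, I x -> lam < w x}.
  have := @ess_inf_le _ _ _ mu (patch (cst +oo%E) I (EFin \o w)).
  apply: filterS => x H Ix; have := lt_le_trans lamI H.
  by rewrite patchT ?inE// lte_fin.
move=> [N [mN N0 IN]]; exists N; split=> // x [Ix Ex].
by apply: IN => /= /(_ Ix).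
Qed.


(** Induction on the number N of levels above the side 2^j.  Either all
    children still have essential infimum at most lam, and the inequality is
    summed over them; or one of them lies almost everywhere in E, and then E fills at
    least the fraction 2^-n of the cube, so that [excess_le] on the whole cube
    suffices.  At the last level the cube lies in V or misses it; in the former
    case the integrand on the right is at least (c - 1) * lam on the cube. *)
Lemma excess_tree_le (j : int) (O : set 'rV[R]_n) (N : nat) (k : 'rV[int]_n) :
  let V : set (Rn R n) := grid_interior j O in
  (ess_inf_on (grid_cube (j + N%:Z) k) w <= lam%:E ->
  \int[mu]_(x in grid_cube (j + N%:Z) k `&` V) h x <=
  \int[mu]_(x in grid_cube (j + N%:Z) k `&` setT)
    ((c - 1) * lam * (2 ^+ n * \1_E x + \1_(V `\` E) x))%:E)%E.
Proof.
move=> V.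
have cl0 : 0 <= (c - 1) * lam by rewrite mulr_ge0// subr_ge0.
have mV : measurable V by exact: grid_interior_measurable.
set g := fun x : Rn R n => ((c - 1) * lam * (2 ^+ n * \1_E x + \1_(V `\` E) x))%:E.
have g0 x : (0 <= g x)%E.
  by rewrite lee_fin mulr_ge0// addr_ge0// mulr_ge0// exprn_ge0.
have mg : measurable_fun [set: Rn R n] g.
  apply/measurable_EFinP; apply: measurable_funM; first exact: measurable_cst.
  apply: measurable_funD; last by apply: measurable_indic; exact: measurableD.
  by apply: measurable_funM; [exact: measurable_cst|exact: measurable_indic].
elim: N k => [|N IHN] k infI.
  set I : set (Rn R n) := grid_cube _ _ in infI *.
  have mI : measurable I by exact: grid_cube_measurable.
  rewrite setIT; have [IV|IV] := grid_interior_dichotomy (j + 0%:Z) k O; last first.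
    rewrite addr0 in IV; rewrite /I addr0 IV integral_set0.
    by apply: integral_ge0 => x _; exact: g0.
  rewrite addr0 -/V in IV.
  have IVE : I `&` V = I by apply/setIidPl; rewrite /I addr0.
  rewrite IVE; apply: (le_trans (excess_le infI)); rewrite -integral_cst//.
  apply: ge0_le_integral => //.
    exact: measurable_funTS.
  move=> x Ix; rewrite lee_fin ler_peMr// !indicE.
  have Vx : V x by have [] : (I `&` V) x by rewrite IVE.
  have [xE|xE] := boolP (x \in E).
    by rewrite mulr1 -[leLHS]addr0 lerD// exprn_ege1// ler1n.
  rewrite mulr0 add0r mem_set//; split=> // Ex.
  by rewrite mem_set in xE.
set I : set (Rn R n) := grid_cube _ _ in infI *.
have mI : measurable I by exact: grid_cube_measurable.
have jN : j + N.+1%:Z - 1 = j + N%:Z by rewrite -addn1 PoszD addrA addrK.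
have [ch|/existsNP[e /negP]] := pselect (forall e,
    (ess_inf_on (grid_cube (j + N%:Z) (grid_child k e)) w <= lam%:E)%E).
  rewrite /I !ge0_integral_children// jN.
  by apply: lee_sum => e _; exact/IHN/ch.
rewrite -ltNge => infC; set C : set (Rn R n) := grid_cube _ _ in infC.
have mC : measurable C by exact: grid_cube_measurable.
have CI : C `<=` I by rewrite /I grid_cube_children jN => x Cx; exists e.
rewrite setIT; apply: (@le_trans _ _ (\int[mu]_(x in I) h x)%E).
  apply: ge0_subset_integral => //; first exact: measurableI.
  exact: measurable_funTS.
apply: (le_trans (excess_le infI)).
rewrite (grid_cube_child_volume R _ _ e) jN -/C.
rewrite -(measure_superlevel_of_lt_ess_inf mC infC) muleA -EFinM -integral_cst; last first.
  exact: measurableI.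
apply: (@le_trans _ _ (\int[mu]_(x in C `&` E) g x)%E).
  apply: ge0_le_integral => //.
  - exact: measurableI.
  - by move=> x _; rewrite lee_fin mulr_ge0// exprn_ge0.
  - exact: measurable_funTS.
  by move=> x [_ Ex]; rewrite lee_fin ler_wpM2l// !indicE mem_set// mulr1 lerDl.
apply: ge0_subset_integral => //; first exact: measurableI.
  exact: measurable_funTS.
by move=> x [/CI].
Qed.

(** The error term of [excess_tree_le] is at most the measure of O outside E, which
    outer regularity makes as small as wanted; the factor (c - 1) lam + 1 in
    the choice of d avoids a division by zero. *)
Lemma excess_le_superlevel (m : int) (k : 'rV[int]_n) :
  (ess_inf_on (grid_cube m k) w <= lam%:E)%E ->
  (\int[mu]_(x in grid_cube m k) h x <=
    ((c - 1) * lam * 2 ^+ n)%:E * mu (grid_cube m k `&` E))%E.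
Proof.
set I : set (Rn R n) := grid_cube m k => infI.
have cl0 : 0 <= (c - 1) * lam by rewrite mulr_ge0// subr_ge0.
have mI : measurable I by exact: grid_cube_measurable.
have mIE : measurable (I `&` E) by exact: measurableI.
have IEoo : (mu (I `&` E) < +oo)%E.
  apply: le_lt_trans (box_finite (n := n) _ _); apply: le_measure (@subIsetl _ _ _).
    by rewrite inE.
  by rewrite inE.
apply/lee_addgt0Pr => eps eps0.
pose d := eps / ((c - 1) * lam + 1).
have cl1 : 0 < (c - 1) * lam + 1 by rewrite ltr_wpDl.
have d0 : 0 < d by rewrite divr_gt0.
have [U [oU IEU Ud]] := lebesgue_outer_regular d0 IEoo.
pose V N : set (Rn R n) := grid_interior (m - N%:Z) U.
have mV N : measurable (V N) by exact: grid_interior_measurable.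
have mU : measurable (U : set (Rn R n)) by exact: open_measurable_Rn.
have VE N : (mu (I `&` (V N `\` E)) <= d%:E)%E.
  have : (mu (I `&` (V N `\` E)) + mu (I `&` E) <= mu (I `&` E) + d%:E)%E.
    apply: le_trans Ud; rewrite -measureU//; last first.
    - by apply/seteqP; split=> x // [[_ [_ ?]] [_ ?]].
    - by apply: measurableI => //; exact: measurableD.
    apply: le_measure; rewrite ?inE//.
      by apply: measurableU => //; apply: measurableI => //; exact: measurableD.
    move=> x [[_ [Vx _]]|/IEU//]; exact: grid_interior_sub Vx.
  by rewrite addeC leeD2lE// ge0_fin_numE.
have bound N : (\int[mu]_(x in I `&` V N) h x <=
    ((c - 1) * lam * 2 ^+ n)%:E * mu (I `&` E) + eps%:E)%E.
  have mN : m = m - N%:Z + N%:Z by rewrite subrK.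
  have := @excess_tree_le (m - N%:Z) U N k; rewrite -mN => /(_ infI)/le_trans; apply.
  rewrite setIT -/(V N).
  have f0 (x : Rn R n) : I x -> (0 <= (2 ^+ n * \1_E x + \1_(V N `\` E) x)%:E)%E.
    by move=> _; rewrite lee_fin addr_ge0// mulr_ge0// exprn_ge0.
  have mind (A : set (Rn R n)) : measurable A ->
      measurable_fun I (fun x => (\1_A x : R)%:E).
    by move=> mA; apply/measurable_EFinP/measurable_funTS/measurable_indic.
  under eq_integral do rewrite EFinM.
  rewrite ge0_integralZl_EFin//; last first.
    under eq_fun do rewrite EFinD EFinM; apply: emeasurable_funD.
      by apply: measurable_funeM; exact: mind.
    by apply: mind; exact: measurableD.
  under eq_integral do rewrite EFinD EFinM.
  rewrite ge0_integralD//; last 2 first.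
  - by apply: measurable_funeM; exact: mind.
  - by apply: mind; exact: measurableD.
  rewrite ge0_integralZl_EFin//; last exact: mind.
  rewrite !integral_indic//; last exact: measurableD.
  rewrite ge0_muleDr; last 2 first.
  - by rewrite mule_ge0// lee_fin exprn_ge0.
  - by [].
  rewrite muleA -EFinM (setIC E) leeD2l// setIC.
  apply: (@le_trans _ _ (((c - 1) * lam)%:E * d%:E)%E).
    by apply: lee_wpmul2l; [rewrite lee_fin|exact: VE].
  rewrite -EFinM lee_fin /d mulrCA ger_pMr// ler_pdivrMr// mul1r.
  by rewrite lerDl.
have cvgV : (\int[mu]_(x in I `&` V N) h x)%E @[N --> \oo] -->
    (\int[mu]_(x in \bigcup_N (I `&` V N)) h x)%E.
  apply: ge0_nondecreasing_set_cvg_integral => //.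
  - move=> a b ab; rewrite subsetEset; apply: setIS.
    by have := grid_interior_nondecreasing m U ab; rewrite subsetEset.
  - by move=> N; exact: measurableI.
  - by move=> N; exact: measurable_funTS.
rewrite -setI_bigcupr grid_interior_open// in cvgV.
apply: (@le_trans _ _ (\int[mu]_(x in I `&` U) h x)%E); last first.
  rewrite -(cvg_lim _ cvgV)//; apply: lime_le; first by apply/cvg_ex; eexists; exact: cvgV.
  exact: nearW.
rewrite integral_mkcond [leRHS]integral_mkcond; apply: ge0_le_integral => //.
- by move=> x _; apply: erestrict_ge0.
- by apply/(measurable_restrictT _ mI); exact: measurable_funTS.
- have mIU : measurable (I `&` U) by exact: measurableI.
  apply/(measurable_restrictT _ mIU); exact: measurable_funTS.
- move=> x _; rewrite !patchE; case: ifPn => [/set_mem Ix|_]; last first.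
    by case: ifP.
  case: ifPn => // /negP IUx; rewrite lee_fin ge_max lexx subr_le0 leNgt.
  by apply/negP => Ex; apply: IUx; apply/mem_set; split=> //; exact: IEU.
Qed.

End stopping_cubes.

(** * The non-increasing rearrangement *)

Section rearrangement_theory.
Context (R : realType) (n : nat).
Local Notation mu := (@lebesgue_measure_Rn R n).
Variables (Q : set (Rn R n)) (w : Rn R n -> R).
Hypotheses (mQ : measurable Q) (Qoo : (mu Q < +oo)%E).
Hypotheses (mw : measurable_fun [set: Rn R n] w) (w0 : forall x, 0 <= w x).
Local Open Scope ereal_scope.
Local Notation wstar := (rearrangement Q w).

Lemma superlevel_measurable (s : R) : measurable (Q `&` [set x | (s < w x)%R]).
Proof.
have -> : [set x | (s < w x)%R] = [set: Rn R n] `&` w @^-1` `]s, +oo[%classic.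
  by rewrite setTI; apply/seteqP; split=> x /=; rewrite in_itv/= andbT.
by apply: measurableI => //; exact: mw.
Qed.

Lemma rearrangement_ge (e : set (Rn R n)) (s : R) (t : R) :
  measurable e -> e `<=` Q -> t%:E <= mu e -> (forall x, e x -> (s <= w x)%R) ->
  s%:E <= wstar t.
Proof.
move=> me eQ te se; apply: (@le_trans _ _ (ereal_inf [set (w x)%:E | x in e])).
  by apply: le_ereal_inf_tmp => _ [x ex <-]; rewrite lee_fin se.
by apply: ereal_sup_ubound; exists e.
Qed.

Lemma rearrangement_gt (s t : R) : s%:E < wstar t ->
  t%:E <= mu (Q `&` [set x | (s < w x)%R]).
Proof.
move=> /ereal_sup_gt[_ [e [me eQ te] <-] se]; apply: le_trans te _.
apply: le_measure; rewrite ?inE//; first exact: superlevel_measurable.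
move=> x ex; split; [exact: eQ|rewrite /= -lte_fin; apply: lt_le_trans se _].
by apply: ereal_inf_lbound; exists x.
Qed.

Lemma rearrangement_nonincreasing (s t : R) : (s <= t)%R -> wstar t <= wstar s.
Proof.
move=> st; apply: ge_ereal_sup => _ [e [me eQ te] <-].
by apply: ereal_sup_ubound; exists e => //; split=> //; rewrite (le_trans _ te)// lee_fin.
Qed.

Lemma rearrangement_ge0 (t : R) : t%:E <= mu Q -> 0 <= wstar t.
Proof. by move=> tQ; apply: (@rearrangement_ge Q). Qed.

Lemma rearrangement_fin_num (t : R) : (0 < t)%R -> t%:E <= mu Q ->
  \int[mu]_(x in Q) (w x)%:E < +oo -> wstar t \is a fin_num.
Proof.
move=> t0 tQ wQ; rewrite ge0_fin_numE ?rearrangement_ge0//.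
apply: (@le_lt_trans _ _ ((t^-1)%:E * \int[mu]_(x in Q) (w x)%:E)); last first.
  rewrite -(fineK (x := \int[mu]_(x in Q) _)) -?EFinM ?ltry//.
  by rewrite ge0_fin_numE// integral_ge0// => x _; rewrite lee_fin.
apply: ge_ereal_sup => _ [e [me eQ te] <-].
rewrite -(@lee_pmul2l _ t%:E) ?lte_fin// muleA -EFinM divff ?gt_eqF// mul1e.
have inf0 : 0 <= ereal_inf [set (w x)%:E | x in e].
  by apply: le_ereal_inf_tmp => _ [x _ <-]; rewrite lee_fin.
apply: (@le_trans _ _ (mu e * ereal_inf [set (w x)%:E | x in e])).
  exact: lee_wpmul2r.
rewrite muleC -integral_cst//.
apply: (@le_trans _ _ (\int[mu]_(x in e) (w x)%:E)).
  apply: ge0_le_integral => //.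
    by apply/measurable_EFinP; exact: measurable_funTS.
  by move=> x ex; apply: ereal_inf_lbound; exists x.
apply: ge0_subset_integral => //.
  by apply/measurable_EFinP; exact: measurable_funTS.
by move=> x _; rewrite lee_fin.
Qed.

(** Any level strictly below the essential infimum has a superlevel set of full
    measure in Q, which competes in the supremum defining the rearrangement. *)
Lemma ess_inf_on_le_rearrangement (t : R) : t%:E <= mu Q ->
  ess_inf_on Q w <= wstar t.
Proof.
move=> tQ; rewrite leNgt; apply/negP => lt_inf.
have [s s_inf t_s] : exists2 s : R, s%:E < ess_inf_on Q w & wstar t < s%:E.
  have := rearrangement_ge0 tQ.
  case: (wstar t) lt_inf => [l| |]; case: (ess_inf_on Q w) => [r| |]//.
    by rewrite lte_fin => lr _; exists ((l + r) / 2)%R; rewrite lte_fin; lra.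
  by exists (l + 1)%R; rewrite ?ltry// lte_fin ltrDl.
have : s%:E <= wstar t.
  apply: (@rearrangement_ge (Q `&` [set x | (s < w x)%R])) => //.
  - exact: superlevel_measurable.
  - by rewrite (measure_superlevel_of_lt_ess_inf mw mQ s_inf).
  - by move=> x [_ /ltW].
by rewrite leNgt t_s.
Qed.

(** A superlevel set at lam + 1/(k+1) of measure more than t would force
    the rearrangement at t above lam; these sets increase to the one at lam. *)
Lemma measure_superlevel_rearrangement (t lam : R) : wstar t = lam%:E ->
  mu (Q `&` [set x | (lam < w x)%R]) <= t%:E.
Proof.
move=> wt.
pose F (k : nat) : set (Rn R n) := Q `&` [set x | (lam + k.+1%:R^-1 < w x)%R].
have mF k : measurable (F k) by exact: superlevel_measurable.
have -> : Q `&` [set x | (lam < w x)%R] = \bigcup_k F k.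
  apply/seteqP; split=> [x [Qx /= wx]|x [k _ [Qx /= wx]]]; last first.
    by split=> //=; apply: le_lt_trans wx; rewrite lerDl invr_ge0.
  have wx0 : (0 < w x - lam)%R by rewrite subr_gt0.
  exists (Num.truncn (w x - lam)^-1) => //; split=> //=.
  rewrite -ltrBrDl invf_plt ?posrE//; exact: truncnS_gt.
have Fk k : mu (F k) <= t%:E.
  rewrite leNgt; apply/negP => tF.
  have : (lam + k.+1%:R^-1)%:E <= wstar t.
    by apply: (@rearrangement_ge (F k)) => [//| | |x [_ /ltW]//]; [exact: subIsetl|exact: ltW].
  by rewrite wt lee_fin gerDl leNgt invr_gt0 ltr0Sn.
have := @nondecreasing_cvg_mu _ _ _ mu F mF.
have mUF : measurable (\bigcup_k F k) by exact: bigcupT_measurable.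
have ndF : nondecreasing_seq F.
  move=> a b ab; rewrite subsetEset => x [Qx /= wx]; split=> //=.
  by apply: le_lt_trans wx; rewrite lerD2l lef_pV2 ?posrE// ler_nat.
move=> /(_ mUF ndF) cvgF.
rewrite -(cvg_lim _ cvgF)//; apply: lime_le; last exact: nearW.
by apply/cvg_ex; eexists; exact: cvgF.
Qed.

(** By monotonicity, the superlevel sets are intervals. *)
Lemma rearrangement_measurable (t : R) :
  measurable_fun (`]0%R, t]%classic : set R) wstar.
Proof.
apply: (measurability _ (ErealGenOInfty.measurableE R)) => _ [_ [s ->] <-].
apply: is_interval_measurable => y z [+ sy] [+ sz] x /andP[yx xz].
rewrite /= !in_itv/= => /andP[y0 yt] /andP[z0 zt].
split; first by rewrite /= ?in_itv/= (lt_le_trans y0 yx) (le_trans xz zt).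
by move: sz; rewrite /= !in_itv/= !andbT => /lt_le_trans; apply;
exact: rearrangement_nonincreasing.
Qed.

End rearrangement_theory.

(** * The integral of the rearrangement *)

Section layer_cake.
Context (R : realType).
Local Open Scope ereal_scope.

(** For finite x, the number x - lam is less than d times one more than the number of levels
    lam + k d, k >= 1, up to x; the constant is 2 because the last of these levels may
    equal x, and only those strictly below x are counted.
    For x infinite the sum diverges. *)
Lemma le_layer_sum (lam d : R) (x : \bar R) : (0 < d)%R -> lam%:E <= x ->
  x <= (lam + 2 * d)%:E +
    \sum_(k <oo) (d * ((lam + k.+1%:R * d)%:E < x)%E%:R)%:E.
Proof.
move=> d0 lamx.
have f0 (k : nat) : 0 <= (d * ((lam + k.+1%:R * d)%:E < x)%E%:R)%:E.
  by rewrite lee_fin mulr_ge0// ltW.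
have sum_ge (N : nat) : (forall k, (k < N)%N -> (lam + k.+1%:R * d)%:E < x) ->
    (N%:R * d)%:E <= \sum_(k <oo) (d * ((lam + k.+1%:R * d)%:E < x)%E%:R)%:E.
  move=> Nx; apply: le_trans (nneseries_lim_ge N (fun k _ _ => f0 k)).
  rewrite big_mkord (eq_bigr (fun=> d%:E)) => [|k _]; last by rewrite Nx// mulr1.
  by rewrite sumEFin sumr_const card_ord mulr_natl.
move: lamx f0 sum_ge; case: x => [x| |]// lamx f0 sum_ge; last first.
  rewrite (_ : \sum_(k <oo) _ = +oo) ?addey//; apply/eqyP => A A0.
  apply: le_trans (sum_ge (Num.truncn (A / d)).+1 _); last by move=> k _; exact: ltry.
  by rewrite lee_fin -ler_pdivrMr//; exact/ltW/truncnS_gt.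
rewrite lee_fin in lamx.
have z0 : (0 <= (x - lam) / d)%R by rewrite divr_ge0 ?subr_ge0// ltW.
have := truncn_itv z0; set N := Num.truncn _ => /andP[].
rewrite ler_pdivlMr// ltr_pdivrMr// => Nx xN.
apply: (@le_trans _ _ ((lam + 2 * d)%:E + (N.-1%:R * d)%:E)).
  rewrite -EFinD lee_fin; move: Nx xN; case: N => [|N] /= Nx; first by lra.
  by rewrite -(natr1 N.+1) -(natr1 N); lra.
apply: leeD2l; apply: sum_ge => k kN; rewrite lte_fin.
apply: lt_le_trans (_ : lam + N%:R * d <= x)%R; last by lra.
by rewrite ltrD2l ltr_pM2r// ltr_nat; case: N kN {Nx xN} => // N; rewrite /= ltnS.
Qed.

Lemma layer_sum_le (lam d : R) (x : R) : (0 < d)%R ->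
  \sum_(k <oo) (d * ((lam + k.+1%:R * d)%:E < x%:E)%E%:R)%:E <= (Num.max 0 (x - lam))%:E.
Proof.
move=> d0; apply: lime_le.
  by apply: is_cvg_nneseries => k _ _; rewrite lee_fin mulr_ge0// ltW.
apply: nearW => N; rewrite big_mkord sumEFin lee_fin.
suff [] : (\sum_(i < N) d * ((lam + i.+1%:R * d)%:E < x%:E)%E%:R <= Num.max 0 (x - lam))%R /\
  (\sum_(i < N) d * ((lam + i.+1%:R * d)%:E < x%:E)%E%:R <= N%:R * d)%R by [].
elim: N => [|N [IH1 IH2]]; first by rewrite big_ord0 mul0r le_max lexx.
rewrite big_ord_recr/= lte_fin; split; last first.
  rewrite -natr1 mulrDl mul1r lerD// ler_piMr//; first exact: ltW.
  by case: (_ < _)%R.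
case: ltP => h; last by rewrite mulr0 addr0.
rewrite le_max mulr1; apply/orP; right.
apply: (@le_trans _ _ (N.+1%:R * d)%R); last by lra.
by rewrite -natr1 mulrDl mul1r lerD2r.
Qed.

End layer_cake.

Section rearrangement_integral.
Context (R : realType) (n : nat).
Local Notation mu := (@lebesgue_measure_Rn R n).
Variables (Q : set (Rn R n)) (w : Rn R n -> R).
Hypotheses (mQ : measurable Q) (Qoo : (mu Q < +oo)%E).
Hypotheses (mw : measurable_fun [set: Rn R n] w) (w0 : forall x, 0 <= w x).
Local Open Scope ereal_scope.
Local Notation wstar := (rearrangement Q w).

(** Half of the equimeasurability of w and its rearrangement. *)
Lemma rearrangement_superlevel_measure (s t : R) :
  lebesgue_measure (`]0%R, t] `&` [set y | s%:E < wstar y] : set R) <=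
  mu (Q `&` [set x | (s < w x)%R]).
Proof.
set B := mu _.
have Bfin : B \is a fin_num.
  rewrite ge0_fin_numE ?measure_ge0//; apply: le_lt_trans Qoo.
  by apply: le_measure; rewrite ?inE//; exact: superlevel_measurable.
apply: (@le_trans _ _ (lebesgue_measure (`]0%R, fine B] : set R))).
  apply: le_measure; rewrite ?inE//.
    apply: emeasurable_fun_o_infty; first exact: measurable_itv.
    exact: rearrangement_measurable.
  move=> y [/= + sy]; rewrite !in_itv/= => /andP[-> _] /=.
  by rewrite -lee_fin fineK// rearrangement_gt.
rewrite lebesgue_measure_itv/= lte_fin; case: ltP => _; last exact: measure_ge0.
by rewrite -EFinB subr0 fineK.
Qed.

(** Discrete layer cake: both integrals are compared with sums of measures of
    superlevel sets at the levels lam + k d.  The rearrangement exceeds its sum by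
    at most 2 d over a length t, and d is chosen to make this equal to e. *)
Lemma integral_rearrangement_le (t lam : R) : (0 < t)%R -> t%:E <= mu Q ->
  (0 <= lam)%R -> lam%:E <= wstar t ->
  \int[lebesgue_measure]_(y in `]0%R, t]) wstar y <=
  (lam * t)%:E + \int[mu]_(x in Q) (Num.max 0 (w x - lam))%:E.
Proof.
move=> t0 tQ lam0 lamt; apply/lee_addgt0Pr => e e0.
pose d : R := (e / (2 * t))%R.
have d0 : (0 < d)%R by rewrite divr_gt0// mulr_gt0.
have dt : (2 * d * t = e)%R.
  by rewrite /d; field; rewrite gt_eqF.
set D : set R := `]0%R, t]%classic.
have mD : measurable D by exact: measurable_itv.
pose A k : set R := D `&` [set y | (lam + k.+1%:R * d)%:E < wstar y].
pose B k : set (Rn R n) := Q `&` [set x | (lam + k.+1%:R * d < w x)%R].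
have mA k : measurable (A k).
  by apply: emeasurable_fun_o_infty => //; exact: rearrangement_measurable.
have mB k : measurable (B k) by exact: superlevel_measurable.
have mA1 k : measurable_fun D (fun y : R => (\1_(A k) y)%:E).
  by apply/measurable_EFinP; apply: measurable_funTS; exact: measurable_indic.
have mB1 k : measurable_fun Q (fun x => (\1_(B k) x : R)%:E).
  by apply/measurable_EFinP; apply: measurable_funTS; exact: measurable_indic.
have d1 (b : R) : (0 <= b)%R -> 0 <= d%:E * b%:E.
  by move=> b0; rewrite mule_ge0// lee_fin// ltW.
apply: (@le_trans _ _ (\int[lebesgue_measure]_(y in D)
    ((lam + 2 * d)%:E + \sum_(k <oo) (d%:E * (\1_(A k) y)%:E)))).
  apply: ge0_le_integral => //.
  - move=> y; rewrite /D/= in_itv/= => /andP[y0 yt]; apply: rearrangement_ge0 => //.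
    by apply: le_trans tQ; rewrite lee_fin.
  - exact: rearrangement_measurable.
  - apply: emeasurable_funD; first exact: measurable_cst.
    rewrite (_ : (fun x => _) = (fun x => \sum_(k <oo | k \in xpredT) (d%:E * (\1_(A k) x)%:E))).
      apply: ge0_emeasurable_sum => [k y _ _|k _]; first exact: d1.
      by apply: measurable_funeM; exact: mA1.
    by apply/funext => x; apply: eq_eseriesl.
  - move=> y Dy.
    have lamy : lam%:E <= wstar y.
      apply: le_trans lamt _; apply: rearrangement_nonincreasing.
      by move: Dy; rewrite /D/= in_itv/= => /andP[].
    apply: le_trans (le_layer_sum d0 lamy) _; apply: leeD2l.
    apply: lee_nneseries => k; first by rewrite lee_fin mulr_ge0// ltW.
    move=> _; rewrite -EFinM lee_fin indicE /A.
    case: ltP => h; last by rewrite mulr0 mulr_ge0// ltW.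
    by rewrite mem_set.
rewrite ge0_integralD//; last 3 first.
- by move=> y _; rewrite lee_fin addr_ge0// mulr_ge0// ltW.
- by move=> y _; apply: nneseries_ge0 => k _ _; exact: d1.
- rewrite (_ : (fun x => _) = (fun x => \sum_(k <oo | k \in xpredT) (d%:E * (\1_(A k) x)%:E))).
    apply: ge0_emeasurable_sum => [k y _ _|k _]; first exact: d1.
    by apply: measurable_funeM; exact: mA1.
  by apply/funext => x; apply: eq_eseriesl.
have -> : \int[lebesgue_measure]_(y in D) (lam + 2 * d)%:E = (lam * t)%:E + e%:E.
  transitivity ((lam + 2 * d)%:E * lebesgue_measure D); first by rewrite -integral_cst.
  rewrite /D lebesgue_measure_itv/= lte_fin t0 -EFinB subr0.
  by rewrite -EFinM -EFinD; congr EFin; rewrite mulrDl dt.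
rewrite [leRHS]addeAC; apply: leeD2l.
rewrite integral_nneseries//; last 2 first.
- by move=> k; apply: measurable_funeM; exact: mA1.
- by move=> k y _; exact: d1.
apply: (@le_trans _ _ (\sum_(k <oo) \int[mu]_(x in Q) (d%:E * (\1_(B k) x)%:E))).
  apply: lee_nneseries => k; first by move=> _ _; apply: integral_ge0 => y _; exact: d1.
  move=> _; rewrite !ge0_integralZl_EFin ?(ltW d0)//; last exact: mA1.
  rewrite !integral_indic//; last exact: mA.
  apply: lee_wpmul2l; first by rewrite lee_fin ltW.
  rewrite /A setIAC setIid /B setIAC setIid.
  exact: rearrangement_superlevel_measure.
rewrite -(@integral_nneseries _ _ _ mu _ mQ (fun k x => d%:E * (\1_(B k) x)%:E)); last 2 first.
- by move=> k; apply: measurable_funeM; exact: mB1.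
- by move=> k y _; exact: d1.
apply: ge0_le_integral => //.
- by move=> y _; apply: nneseries_ge0 => k _ _; exact: d1.
- rewrite (_ : (fun x => _) = (fun x => \sum_(k <oo | k \in xpredT) (d%:E * (\1_(B k) x)%:E))).
    apply: ge0_emeasurable_sum => [k y _ _|k _]; first exact: d1.
    by apply: measurable_funeM; exact: mB1.
  by apply/funext => x; apply: eq_eseriesl.
- apply/measurable_EFinP; apply: measurable_funTS; apply: measurable_maxr.
    exact: measurable_cst.
  by apply: measurable_funB => //; exact: measurable_cst.
move=> x Qx; apply: le_trans _ (layer_sum_le lam (w x) d0); apply: lee_nneseries => k.
  by move=> _ _; exact: d1.
move=> _; rewrite -EFinM lee_fin indicE lte_fin; case: (boolP (x \in B k)) => [/set_mem[_ /= ->//]|_].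
by rewrite mulr0 mulr_ge0// ltW.
Qed.

End rearrangement_integral.

(** * The inequality and its extremal weight *)

Section upper_bound.
Context (R : realType) (n : nat).
Local Notation mu := (@lebesgue_measure_Rn R n).
Local Open Scope ereal_scope.

Lemma dyadic_A1_rearrangement_bound (Q : set (Rn R n)) (w : Rn R n -> R) (c : R) :
  dyadic_cube Q -> dyadic_A1_weight w -> dyadic_A1_bound w c ->
  rearrangement_bound Q w (2 ^+ n * c - 2 ^+ n + 1)%R.
Proof.
move=> [m [k QE]] [lw w0 _] [c1 A1] t t0 tQ.
have mw := lw.1.
have {}QE : Q = grid_cube m k by [].
have mQ : measurable Q by rewrite QE; exact: grid_cube_measurable.
have Qoo : mu Q < +oo by rewrite QE; exact: box_finite.
have wQ : \int[mu]_(x in Q) (w x)%:E < +oo.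
  under eq_integral do rewrite -[w _]ger0_norm//.
  by rewrite QE; exact: locally_integrable_box.
have /fineK/esym := rearrangement_fin_num mQ mw w0 t0 tQ wQ.
set lam := fine _ => wt.
have lam0 : (0 <= lam)%R by rewrite fine_ge0// rearrangement_ge0.
have infQ : ess_inf_on Q w <= lam%:E.
  rewrite -wt; apply: ess_inf_on_le_rearrangement => //.
have wsup : mu (Q `&` [set x | (lam < w x)%R]) <= t%:E.
  exact: measure_superlevel_rearrangement.
have cl0 : (0 <= (c - 1) * lam)%R by rewrite mulr_ge0// subr_ge0.
rewrite wt lee_pdivrMl//.
have lamt : lam%:E <= rearrangement Q w t by rewrite wt.
apply: (le_trans (integral_rearrangement_le mQ Qoo mw w0 t0 tQ lam0 lamt)).
have -> : t%:E * ((2 ^+ n * c - 2 ^+ n + 1)%:E * lam%:E) =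
    (lam * t)%:E + ((c - 1) * lam * 2 ^+ n)%:E * t%:E.
  by rewrite -!EFinM -EFinD; congr EFin; ring.
apply: leeD2l; rewrite {1}QE.
have infQ' : ess_inf_on (grid_cube m k) w <= lam%:E by rewrite -QE.
apply: (le_trans (excess_le_superlevel mw w0 c1 lam0 A1 infQ')).
by rewrite -QE; apply: lee_wpmul2l => //; rewrite lee_fin mulr_ge0// exprn_ge0.
Qed.

End upper_bound.

Section extremal_weight.
Context (R : realType) (n : nat).
Local Notation mu := (@lebesgue_measure_Rn R n).
Local Open Scope ereal_scope.

Lemma grid_index_coarsen (m : int) (N : nat) (x y : 'rV[R]_n) :
  grid_index (m - N%:Z) x = grid_index (m - N%:Z) y -> grid_index m x = grid_index m y.
Proof.
elim: N m => [|N IHN] m; first by rewrite subr0.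
have -> : (m - N.+1%:Z = m - 1 - N%:Z)%R by rewrite -addn1 PoszD opprD [RHS]addrAC addrA.
move=> /IHN xy; have : grid_cube m (grid_index m x) x by exact: grid_cube_index.
rewrite grid_cube_children => -[e _ /grid_cubeE xe].
apply/esym/grid_cubeE; rewrite grid_cube_children; exists e => //.
by apply/grid_cubeE; rewrite -xy.
Qed.

Lemma ess_inf_on_ge (J : set (Rn R n)) (w : Rn R n -> R) (r : R) :
  (forall x, J x -> (r <= w x)%R) -> r%:E <= ess_inf_on J w.
Proof.
move=> rw; apply/ess_infP; apply: nearW => x; rewrite /patch.
by case: ifPn => [/set_mem Jx|_]; rewrite ?leey// lee_fin rw.
Qed.

Variables (m : int) (k : 'rV[int]_n) (c : R).
Hypotheses (n1 : (1 <= n)%N) (c1 : (1 <= c)%R).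

Let Q : set (Rn R n) := grid_cube m k.
Let I : set (Rn R n) := grid_cube (m - 1) (grid_child k [ffun => false]).
Let K : R := ((c - 1) * 2 ^+ n + 1)%R.

(** The value K on I makes the mean over Q equal to c, which leaves no slack
    in the A1 condition on the parent Q of I. *)
Definition extremal_weight (x : Rn R n) : R := (1 + (K - 1) * \1_I x)%R.
Local Notation w := extremal_weight.

Let p0 : (0 < 2 ^+ n :> R)%R. Proof. by rewrite exprn_gt0. Qed.

Let K1 : (1 <= K)%R.
Proof. by rewrite /K lerDr mulr_ge0 ?subr_ge0// ltW. Qed.

Let mI : measurable I. Proof. exact: grid_cube_measurable. Qed.
Let mQ : measurable Q. Proof. exact: grid_cube_measurable. Qed.

Let IQ : I `<=` Q.
Proof. by move=> x Ix; rewrite /Q grid_cube_children; exists [ffun => false]. Qed.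

Let muI : mu I = ((2 ^ (m - 1)) ^+ n)%:E. Proof. exact: grid_cube_volume. Qed.

Let v0 : (0 < (2 ^ (m - 1)) ^+ n :> R)%R.
Proof. by rewrite exprn_gt0// exp2z_gt0. Qed.

Let muQ : mu Q = (2 ^+ n * (2 ^ (m - 1)) ^+ n)%:E.
Proof. by rewrite /Q (grid_cube_child_volume _ _ _ [ffun => false]) -/I muI EFinM. Qed.

Lemma extremal_weight_in x : I x -> w x = K.
Proof. by move=> Ix; rewrite /w indicE mem_set// mulr1 addrC subrK. Qed.

Lemma extremal_weight_out x : ~ I x -> w x = 1%R.
Proof. by move=> Ix; rewrite /w indicE memNset// mulr0 addr0. Qed.

Lemma extremal_weight_ge1 x : (1 <= w x)%R.
Proof. by rewrite /w lerDl mulr_ge0// subr_ge0. Qed.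

Lemma extremal_weight_le x : (w x <= K)%R.
Proof.
have [/extremal_weight_in->//|/extremal_weight_out->] := pselect (I x).
exact: K1.
Qed.

Lemma extremal_weight_measurable : measurable_fun [set: Rn R n] w.
Proof.
apply: measurable_funD; first exact: measurable_cst.
by apply: measurable_funM; [exact: measurable_cst|exact: measurable_indic].
Qed.

Lemma integral_extremal_weight (J : set (Rn R n)) : measurable J ->
  \int[mu]_(x in J) (w x)%:E = mu J + (K - 1)%:E * mu (I `&` J).
Proof.
move=> mJ; under eq_integral do rewrite /w EFinD EFinM.
have m1 : measurable_fun J (fun x => (\1_I x : R)%:E).
  by apply/measurable_EFinP; apply: measurable_funTS; exact: measurable_indic.
rewrite ge0_integralD//; last 2 first.
- by move=> x _; rewrite mule_ge0// lee_fin// subr_ge0.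
- by apply: measurable_funeM; exact: m1.
rewrite integral_cst// mul1e ge0_integralZl_EFin// ?subr_ge0//.
by rewrite integral_indic.
Qed.

Lemma average_leE (m' : int) (k' : 'rV[int]_n) (r : R) :
  (average (grid_cube m' k') w <= r%:E) =
  (\int[mu]_(x in grid_cube m' k') (w x)%:E <= r%:E * mu (grid_cube m' k')).
Proof.
by rewrite /average grid_cube_volume /= lee_pdivrMl ?exprn_gt0 ?exp2z_gt0// muleC.
Qed.

(** A cube no larger than I lies in I or misses it, so the weight is constant on it.
    On a larger cube, at least as large as Q, the mean of the weight is at most its
    mean over Q, which is c. *)
Lemma extremal_weight_A1_bound : dyadic_A1_bound w c.
Proof.
split=> // J [m' [k' JE]]; rewrite -/(grid_cube m' k') in JE; rewrite {J}JE.
set J : set (Rn R n) := grid_cube m' k'.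
have mJ : measurable J by exact: grid_cube_measurable.
have c0 : 0 <= c%:E by rewrite lee_fin (le_trans _ c1).
have mJ0 : 0 <= mu J by exact: measure_ge0.
have [m'm|mm'] := leP m' (m - 1)%R.
  have [N NE] : exists N : nat, m' = (m - 1 - N%:Z)%R.
    exists `|(m - 1 - m')%R|%N; rewrite gez0_abs ?subr_ge0//.
    by rewrite opprB addrC subrK.
  have JI x y : J x -> J y -> I x -> I y.
    rewrite /J NE => /grid_cubeE xJ /grid_cubeE yJ /grid_cubeE xI.
    by apply/grid_cubeE; rewrite -xI; apply: (@grid_index_coarsen _ N); rewrite xJ.
  have [z Jz] : J !=set0 by exact: grid_cube_nonempty.
  have wJ x : J x -> w x = w z.
    move=> Jx; have [Iz|Iz] := pselect (I z).
      by rewrite !extremal_weight_in//; exact: (JI z).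
    by rewrite !extremal_weight_out// => Ix; apply: Iz; exact: (JI x).
  apply: (@le_trans _ _ (w z)%:E).
    rewrite average_leE -/J -integral_cst//; apply: ge0_le_integral => //.
    - by move=> x _; rewrite lee_fin (le_trans _ (extremal_weight_ge1 x)).
    - by apply/measurable_EFinP; apply: measurable_funTS; exact: extremal_weight_measurable.
    - by move=> x Jx; rewrite wJ.
  apply: (@le_trans _ _ (c%:E * (w z)%:E)).
    by rewrite -EFinM lee_fin ler_peMl// (le_trans _ (extremal_weight_ge1 z)).
  by apply: lee_wpmul2l => //; apply: ess_inf_on_ge => x Jx; rewrite wJ.
apply: (@le_trans _ _ (c%:E * 1)); last first.
  apply: lee_wpmul2l => //; apply: (@ess_inf_on_ge J w 1) => x _.
  exact: extremal_weight_ge1.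
rewrite mule1 average_leE -/J integral_extremal_weight//.
apply: (@le_trans _ _ (mu J + (K - 1)%:E * mu I)).
  apply: leeD2l; apply: lee_wpmul2l; first by rewrite lee_fin subr_ge0.
  by apply: le_measure; rewrite ?inE//; exact: measurableI.
have QJ : (2 ^+ n * (2 ^ (m - 1)) ^+ n <= (2 ^ m') ^+ n :> R)%R.
  rewrite -exprMn -exp2z_half lerXn2r ?nnegrE ?exprz_ge0//.
  by rewrite ler_weXz2l ?ler1n//; lia.
rewrite muI /J grid_cube_volume -!EFinM -EFinD lee_fin /K addrK.
have c10 : (0 <= c - 1)%R by rewrite subr_ge0.
have := ler_wpM2l c10 QJ.
by lra.
Qed.

Lemma extremal_weight_A1 : dyadic_A1_weight w.
Proof.
split; last by exists c; exact: extremal_weight_A1_bound.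
  split; first exact: extremal_weight_measurable.
  move=> C cC; have [a [b Cab]] := compact_sub_box cC.
  have mC := compact_measurable_Rn cC.
  apply: (@le_lt_trans _ _ (\int[mu]_(x in box a b) (cst K%:E) x)).
    apply: (@le_trans _ _ (\int[mu]_(x in C) (cst K%:E) x)).
      apply: ge0_le_integral => //.
        apply/measurable_EFinP; apply: measurable_funTS.
        by apply: measurableT_comp => //; exact: extremal_weight_measurable.
      move=> x _; rewrite lee_fin ger0_norm ?extremal_weight_le//.
      by rewrite (le_trans _ (extremal_weight_ge1 x)).
    apply: ge0_subset_integral => //; first exact: box_measurable.
    by move=> x _; rewrite lee_fin (le_trans _ K1).
  rewrite integral_cst; last exact: box_measurable.
  apply: lte_mul_pinfty => //; last exact: box_finite.
  by rewrite lee_fin (le_trans _ K1).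
by move=> x; rewrite (le_trans _ (extremal_weight_ge1 x)).
Qed.

Lemma extremal_weight_A1_constant : is_dyadic_A1_constant w c.
Proof.
split; first exact: extremal_weight_A1_bound.
move=> c' [c'1 A1].
have dQ : dyadic_cube Q by exists m, k.
have infQ : ess_inf_on Q w <= 1.
  rewrite leNgt; apply/negP => inf1.
  have := measure_superlevel_of_lt_ess_inf extremal_weight_measurable mQ inf1.
  apply/eqP; rewrite lt_eqF//.
  apply: (@le_lt_trans _ _ (mu I)).
    apply: le_measure; rewrite ?inE//; first exact: superlevel_measurable extremal_weight_measurable _.
    move=> x [_ /= wx]; apply: contrapT => /extremal_weight_out wx1.
    by rewrite wx1 ltxx in wx.
  rewrite muI muQ lte_fin ltr_pMl// exprn_egt1 ?ltr1n//.
  by rewrite -lt0n.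
have : average Q w <= (c')%:E * 1.
  apply: le_trans (A1 _ dQ) _; apply: lee_wpmul2l => //.
  by rewrite lee_fin (le_trans _ c'1).
rewrite mule1 /Q average_leE -/Q integral_extremal_weight// (setIidl IQ) muI muQ.
rewrite -!EFinM -EFinD lee_fin /K addrK => avg_le.
by rewrite -(ler_pM2r (mulr_gt0 p0 v0)); lra.
Qed.

(** Every set of measure t > |I| meets the region where the weight is 1. *)
Lemma extremal_weight_not_bound (C : R) : (C < K)%R -> ~ rearrangement_bound Q w C.
Proof.
move=> CK.
have K0 : (0 < K)%R by exact: lt_le_trans K1.
(* Here v = |I| and t = v (1 + s), with s > 0 small enough for the mean
   1 + (K - 1) / (1 + s) of the rearrangement over (0, t] to exceed C. *)
pose v : R := ((2 ^ (m - 1)) ^+ n)%R.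
pose s : R := (Num.min 1 ((K - C) / (2 * K)))%R.
have s0 : (0 < s)%R by rewrite lt_min ltr01 divr_gt0 ?subr_gt0// mulr_gt0.
have s1 : (s <= 1)%R by rewrite ge_min lexx.
have sC : (s * (K - 1) < K - C)%R.
  have : (s * (2 * K) <= K - C)%R.
    by rewrite -ler_pdivlMr ?mulr_gt0// ge_min lexx orbT.
  by have := K1; nra.
pose t := (v * (1 + s))%R.
have vt : (v < t)%R by rewrite /t ltr_pMr ?ltrDl//; exact: v0.
have t0 : (0 < t)%R by apply: lt_trans vt; exact: v0.
have tQ : t%:E <= mu Q.
  rewrite muQ lee_fin /t mulrC ler_wpM2r//; first exact: ltW v0.
  apply: (@le_trans _ _ (2 ^+ 1)%R); first by rewrite expr1; lra.
  by rewrite ler_weXn2l// ler1n.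
have wt : rearrangement Q w t = 1.
  apply/eqP; rewrite eq_le; apply/andP; split; last first.
    apply: (@rearrangement_ge _ _ Q w Q 1) => // x _; exact: extremal_weight_ge1.
  apply: ge_ereal_sup => _ [e [me eQ te] <-].
  have [x [ex Ix]] : exists x, e x /\ ~ I x.
    apply: contrapT => H; have eI : e `<=` I.
      by move=> x ex; apply: contrapT => Ix; apply: H; exists x.
    have : mu e <= mu I by apply: le_measure; rewrite ?inE.
    by move=> /(le_trans te); rewrite muI lee_fin leNgt vt.
  by apply: ereal_inf_lbound; exists x => //; rewrite extremal_weight_out.
move=> /(_ t t0 tQ); rewrite wt mule1 lee_pdivrMl//.
pose D : set R := `]0%R, t]%classic.
pose A : set R := `]0%R, v]%classic.
have mD : measurable D by exact: measurable_itv.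
have mA : measurable A by exact: measurable_itv.
have mA1 : measurable_fun D (fun y : R => (\1_A y : R)%:E).
  by apply/measurable_EFinP; apply: measurable_funTS; exact: measurable_indic.
have int1 : \int[lebesgue_measure]_(y in D) 1%:E = t%:E.
  transitivity (1%:E * lebesgue_measure D); first by rewrite -integral_cst.
  by rewrite mul1e /D lebesgue_measure_itv/= lte_fin t0 -EFinB subr0.
have int1A : \int[lebesgue_measure]_(y in D) (\1_A y : R)%:E = v%:E.
  transitivity (lebesgue_measure (A `&` D)); first exact: integral_indic.
  rewrite setIidl; last by rewrite /A /D; apply: subset_itvl; rewrite bnd_simp ltW.
  by rewrite /A lebesgue_measure_itv/= lte_fin v0 -EFinB subr0.
have intA : \int[lebesgue_measure]_(y in D) (1%:E + (K - 1)%:E * (\1_A y : R)%:E) =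
    (t + (K - 1) * v)%:E.
  rewrite ge0_integralD//; last 2 first.
  - by move=> y _; rewrite mule_ge0// lee_fin// subr_ge0.
  - by apply: measurable_funeM; exact: mA1.
  rewrite ge0_integralZl_EFin ?subr_ge0//.
  by rewrite int1 int1A -EFinM -EFinD.
move=> le_int; have : (t + (K - 1) * v)%:E <= t%:E * C%:E.
  apply: le_trans le_int; rewrite -intA; apply: ge0_le_integral => //.
  - by move=> y _; rewrite adde_ge0// mule_ge0// lee_fin// subr_ge0.
  - apply: emeasurable_funD; first exact: measurable_cst.
    by apply: measurable_funeM; exact: mA1.
  - apply: rearrangement_measurable.
  move=> y; rewrite /D/= in_itv/= => /andP[y0 yt].
  rewrite indicE; have [yv|yv] := leP y v.
    rewrite mem_set /A/= ?in_itv/= ?y0// mule1 -EFinD addrC subrK.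
    apply: (@rearrangement_ge _ _ Q w I) => //; first by rewrite muI lee_fin.
    by move=> x /extremal_weight_in ->.
  rewrite memNset /A/= ?in_itv/= ?y0 ?(lt_geF yv)// mule0 adde0.
  apply: (@rearrangement_ge _ _ Q w Q 1) => //.
    by apply: le_trans tQ; rewrite lee_fin.
  by move=> x _; exact: extremal_weight_ge1.
rewrite -EFinM lee_fin /t => H.
have {}H : (1 + s + (K - 1) <= (1 + s) * C)%R.
  by rewrite -(ler_pM2l (v0 : (0 < v)%R)) mulrDr mulrA [(v * (K - 1))%R]mulrC.
by have := K1; nra.
Qed.

End extremal_weight.

Theorem theorem1 (R : realType) (n : nat) (hn : (1 <= n)%N)
    (Q : set (Rn R n)) (hQ : dyadic_cube Q) (c : R) (hc : 1 <= c) :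
  (forall w : Rn R n -> R,
     dyadic_A1_weight w -> is_dyadic_A1_constant w c ->
     rearrangement_bound Q w (2 ^+ n * c - 2 ^+ n + 1)) /\
  (forall C : R, C < 2 ^+ n * c - 2 ^+ n + 1 ->
     ~ (forall w : Rn R n -> R,
          dyadic_A1_weight w -> is_dyadic_A1_constant w c ->
          rearrangement_bound Q w C)).
Proof.
split=> [w wA1 [wc _]|C CK]; first exact: dyadic_A1_rearrangement_bound.
move: hQ => [m [k ->]] bound.
apply: (@extremal_weight_not_bound R n m k c hn hc C).
  by apply: lt_le_trans CK _; rewrite mulrBl mul1r mulrC.
apply: bound; first exact: extremal_weight_A1.
exact: extremal_weight_A1_constant.
Qed.
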